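(* Let $(M,+,0)$ be an idempotent commutative monoid and let $\mathbf{E}_M$ be its endomorphism semiring. The following conditions are equivalent: (i) $\mathbf{E}_M$ is simple; (ii) $\mathbf{E}_M$ is ideal-simple; (iii) the semilattice $M$ is a finite distributive lattice.
   Context: A semiring $(R,+,\cdot,0,1)$ consists of a commutative monoid $(R,+,0)$ and a monoid $(R,\cdot,1)$ such that multiplication distributes over addition on both sides and $0r=0=r0$ for all $r\in R$. An ideal is an additive submonoid closed under left and right multiplication by elements of $R$. A semiring $R$ is ideal-simple if $0$ and $R$ are its only ideals; congruence-simple if the diagonal and the universal relation $R^2$ are its only congruences; simple if it is both ideal-simple and congruence-simple. An idempotent commutative monoid $(M,+,0)$ is viewed as a join-semilattice with least element $0$ under the order $x\le y \iff x+y=y$; ''$M$ is a finite distributive lattice'' means that this ordered set is a finite distributive lattice. $\mathbf{E}_M$ is the set of all monoid endomorphisms of $(M,+,0)$ (maps preserving $+$ and $0$), with pointwise addition and composition as multiplication. *)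

(* Defs.v *)
From HB Require Import structures.
From mathcomp Require Import all_boot all_order all_algebra.
From mathcomp Require Import boolp classical_sets.
Set Implicit Arguments.
Unset Strict Implicit.
Unset Printing Implicit Defensive.

Import GRing.Theory.
Local Open Scope ring_scope.
Local Open Scope classical_set_scope.

(* Semirings are pzSemiRingType's, and not nzSemiRingType's, because 0 = 1 is
   allowed: it holds in the endomorphism semiring of the one-element monoid. *)

Definition is_ideal (R : pzSemiRingType) (I : set R) : Prop :=
  [/\ I 0,
      forall x y, I x -> I y -> I (x + y),
      forall r x, I x -> I (r * x)
    & forall r x, I x -> I (x * r)].

Definition ideal_simple (R : pzSemiRingType) : Prop :=
  forall I : set R, is_ideal I -> I = [set 0] \/ I = [set: R].

Definition is_congruence (R : pzSemiRingType) (C : R -> R -> Prop) : Prop :=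
  [/\ RelationClasses.Equivalence C,
      forall x x' y y', C x x' -> C y y' -> C (x + y) (x' + y')
    & forall x x' y y', C x x' -> C y y' -> C (x * y) (x' * y')].

Definition congruence_simple (R : pzSemiRingType) : Prop :=
  forall C : R -> R -> Prop, is_congruence C ->
    (forall x y, C x y <-> x = y) \/ (forall x y, C x y).

Definition simple_semiring (R : pzSemiRingType) : Prop :=
  ideal_simple R /\ congruence_simple R.

Definition endo (M : nmodType) : Type := {additive M -> M}.

Section Endo.
Variable M : nmodType.
Implicit Types f g h : endo M.

HB.instance Definition _ := gen_eqMixin (endo M).
HB.instance Definition _ := gen_choiceMixin (endo M).

Lemma endoP f g : f =1 g -> f = g.
Proof.
case: f g => [f [[pf]]] [g [[pg]]] /= /funext fg.
by move: pf pg; rewrite fg => pf pg; rewrite (Prop_irrelevance pf pg).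
Qed.

Definition endo_zero : endo M := \0.
Definition endo_add f g : endo M := f \+ g.
Definition endo_one : endo M := idfun.
Definition endo_mul f g : endo M := f \o g.

Lemma endo_addA : associative endo_add.
Proof. by move=> f g h; apply: endoP => x /=; rewrite addrA. Qed.

Lemma endo_addC : commutative endo_add.
Proof. by move=> f g; apply: endoP => x /=; rewrite addrC. Qed.

Lemma endo_add0 : left_id endo_zero endo_add.
Proof. by move=> f; apply: endoP => x /=; rewrite add0r. Qed.

Lemma endo_mulA : associative endo_mul.
Proof. by move=> f g h; apply: endoP. Qed.

Lemma endo_mul1 : left_id endo_one endo_mul.
Proof. by move=> f; apply: endoP. Qed.

Lemma endo_mulr1 : right_id endo_one endo_mul.
Proof. by move=> f; apply: endoP. Qed.

Lemma endo_mulDl : left_distributive endo_mul endo_add.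
Proof. by move=> f g h; apply: endoP. Qed.

Lemma endo_mulDr : right_distributive endo_mul endo_add.
Proof. by move=> f g h; apply: endoP => x /=; rewrite raddfD. Qed.

Lemma endo_mul0 : left_zero endo_zero endo_mul.
Proof. by move=> f; apply: endoP. Qed.

Lemma endo_mulr0 : right_zero endo_zero endo_mul.
Proof. by move=> f; apply: endoP => x /=; rewrite raddf0. Qed.

HB.instance Definition _ := GRing.isPzSemiRing.Build (endo M)
  endo_addA endo_addC endo_add0 endo_mulA endo_mul1 endo_mulr1
  endo_mulDl endo_mulDr endo_mul0 endo_mulr0.

End Endo.

(* The semilattice order, x <= y iff x + y = y, on an idempotent monoid. *)
Definition semilattice_le (M : nmodType) (x y : M) : Prop := x + y = y.

(* M, ordered by semilattice_le, is a finite distributive lattice, i.e. it is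
   isomorphic as an ordered set to a finDistrLatticeType. *)
Definition is_finite_distr_lattice (M : nmodType) : Prop :=
  exists (d : Order.disp_t) (L : finDistrLatticeType d) (f : M -> L),
    bijective f /\ forall x y, (f x <= f y)%O <-> semilattice_le x y.

(* Main.v *)
Require Import Defs.
From HB Require Import structures.
From mathcomp Require Import all_boot all_order all_algebra.
From mathcomp Require Import boolp classical_sets.
Set Implicit Arguments.
Unset Strict Implicit.
Unset Printing Implicit Defensive.
Import Order.TTheory GRing.Theory.
Local Open Scope ring_scope.

(** Call a map [p : M -> bool] a character if [p 0 = false] and
    [p (x + y) = p x || p y]; for [b] in [M], the step map [p b] sends [x] to
    [b] if [p x] and to [0] otherwise. If [phi m <> 0], every step map is
    [s1 \o phi \o s2] for two step maps [s1], [s2], so every nonzero ideal of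
    [endo M] contains all finite sums of step maps; these sums form an ideal.
    Hence [endo M] is ideal-simple iff the identity is a finite sum of step
    maps, [x = \sum_(p <- s | p.1 x) p.2]. Such a formula embeds [M] in a power
    of [bool], provides meets by summing over [p.1 x && p.1 y], and makes them
    distribute over joins. Conversely, in a finite distributive lattice every
    element is the join of the join-primes below it. Finally, if a congruence
    identifies two distinct endomorphisms then, after composition with step
    maps, it identifies some nonzero one with [0]; so ideal-simplicity implies
    congruence-simplicity. *)

Local Notation "x <=s y" := (semilattice_le x y) (at level 70).

Record character (M : nmodType) := Character {
  character_fun :> M -> bool;
  character0 : character_fun 0 = false;
  characterD : {morph character_fun : x y / x + y >-> x || y} }.

Section EndoEval.
Variables (M : nmodType) (f g : endo M) (x : M).

Lemma endo0E : (0 : endo M) x = 0. Proof. reflexivity. Qed.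
Lemma endoDE : (f + g) x = f x + g x. Proof. reflexivity. Qed.
Lemma endoME : (f * g) x = f (g x). Proof. reflexivity. Qed.
Definition endoE := (endo0E, endoDE, endoME).

End EndoEval.

Section Idempotent.
Variables (M : nmodType) (addxx : forall x : M, x + x = x).
Implicit Types (x y z b : M) (p : character M) (f g : endo M).
Implicit Types (s : seq (character M * M)).

(** * Order and sums in an idempotent monoid *)

Lemma sle_refl x : x <=s x. Proof. exact: addxx. Qed.

Lemma sle_anti x y : x <=s y -> y <=s x -> x = y.
Proof. by rewrite /semilattice_le addrC => yE xE; rewrite -xE. Qed.

Lemma sle_trans y x z : x <=s y -> y <=s z -> x <=s z.
Proof. by rewrite /semilattice_le => xy <-; rewrite addrA xy. Qed.

Lemma sle0x x : 0 <=s x. Proof. exact: add0r. Qed.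

Lemma sle_addl x y : x <=s x + y.
Proof. by rewrite /semilattice_le addrA addxx. Qed.

Lemma sle_addr x y : y <=s x + y.
Proof. by rewrite addrC; apply: sle_addl. Qed.

Lemma addr_sle x y z : x + y <=s z <-> x <=s z /\ y <=s z.
Proof.
split=> [xyz|[xz yz]]; last by rewrite /semilattice_le -addrA yz.
by split; apply: sle_trans xyz; [apply: sle_addl|apply: sle_addr].
Qed.

Lemma sle_sum (I : Type) (r : seq I) (P : pred I) (F : I -> M) z :
  (forall i, P i -> F i <=s z) -> \sum_(i <- r | P i) F i <=s z.
Proof.
by move=> Fz; elim/big_ind: _ => // [|x y xz yz]; [apply: sle0x|apply/addr_sle].
Qed.

(** Idempotence absorbs the terms that occur in both sums. *)
Lemma sum_orb (I : Type) (r : seq I) (P Q : pred I) (F : I -> M) :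
  \sum_(i <- r | P i || Q i) F i =
  \sum_(i <- r | P i) F i + \sum_(i <- r | Q i) F i.
Proof.
rewrite !(big_mkcond _ F) -big_split; apply: eq_bigr => i _.
by case: (P i); case: (Q i); rewrite /= ?addr0 ?add0r ?addxx.
Qed.

Lemma sle_sum_sub (I : Type) (r : seq I) (P Q : pred I) (F : I -> M) :
  subpred P Q -> \sum_(i <- r | P i) F i <=s \sum_(i <- r | Q i) F i.
Proof.
move=> PQ; rewrite /semilattice_le -sum_orb; apply: eq_bigl => i.
by have := PQ i; case: (P i) => // ->.
Qed.

(** * Characters *)

Lemma character_homo p x y : x <=s y -> p x -> p y.
Proof. by move=> <- px; rewrite characterD px. Qed.

Fact nonzero_morph : {morph (fun x => x != 0) : x y / x + y >-> x || y}.
Proof.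
move=> x y; have [->|x0] := eqVneq x 0; first by rewrite add0r.
apply/eqP => xy0; move/eqP: x0; apply; apply: sle_anti (sle0x x).
by rewrite -xy0; apply: sle_addl.
Qed.

Definition nonzero_character : character M :=
  @Character M (fun x => x != 0) (negbF (eqxx 0)) nonzero_morph.

Fact not_below_proof y :
  `[< ~ 0 <=s y >] = false /\
  {morph (fun x => `[< ~ x <=s y >]) : x z / x + z >-> x || z}.
Proof.
split=> [|x z]; first by apply/asboolPn => /(_ (sle0x y)).
by rewrite -asbool_or; apply: asbool_equiv_eq; rewrite addr_sle not_andE.
Qed.

(** It separates [y] from every element not below [y]. *)
Definition not_below y : character M :=
  Character (not_below_proof y).1 (not_below_proof y).2.

Fact comp_character_proof p f :
  p (f 0) = false /\ {morph (fun x => p (f x)) : x y / x + y >-> x || y}.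
Proof. by split=> [|x y]; rewrite ?raddf0 ?character0 // raddfD characterD. Qed.

Definition comp_character p f : character M :=
  Character (comp_character_proof p f).1 (comp_character_proof p f).2.

(** * Step maps and the ideal of their sums *)

Definition step_fun p b x : M := if p x then b else 0.

Fact step_fun_is_nmod_morphism p b : nmod_morphism (step_fun p b).
Proof.
split=> [|x y]; rewrite /step_fun ?character0 // characterD.
by case: (p x); case: (p y); rewrite /= ?addr0 ?add0r ?addxx.
Qed.

HB.instance Definition _ p b :=
  GRing.isNmodMorphism.Build M M (step_fun p b) (step_fun_is_nmod_morphism p b).

Definition step p b : endo M := step_fun p b.

Definition step_sum f : Prop :=
  exists s, forall x, f x = \sum_(q <- s | q.1 x) q.2.

Lemma step_sum_ideal : is_ideal step_sum.
Proof.
split.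
- by exists [::] => x; rewrite big_nil endo0E.
- move=> f g [s fE] [t gE]; exists (s ++ t) => x.
  by rewrite big_cat endoE -fE -gE.
- move=> r f [s fE]; exists [seq (q.1, r q.2) | q <- s] => x.
  by rewrite big_map endoE /= -raddf_sum -fE.
- move=> r f [s fE]; exists [seq (comp_character q.1 r, q.2) | q <- s] => x.
  by rewrite big_map endoE fE.
Qed.

Lemma step_in_step_sum p b : step_sum (step p b).
Proof. by exists [:: (p, b)] => x; rewrite big_cons big_nil addr0. Qed.

(** The right factor turns [x] into [m] or [0] according to [p x]; as [f m] is nonzero,
    [nonzero_character] reads [p x] back from the image under [f]. *)
Lemma step_mul p b f m : f m != 0 ->
  step nonzero_character b * f * step p m = step p b.
Proof.
move=> fm0; apply: endoP => x; rewrite !endoE /= /step_fun /=.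
by case: (p x); rewrite ?raddf0 ?fm0 ?eqxx.
Qed.

Lemma step_sum_sub_ideal (I : set (endo M)) f m :
  is_ideal I -> I f -> f m != 0 -> forall g, step_sum g -> I g.
Proof.
move=> [I0 ID Il Ir] If fm0 g [s]; elim: s g => [|[p b] s IHs] g gE.
  by rewrite [g](_ : _ = 0) //; apply: endoP => x; rewrite gE big_nil.
(* [IHs] speaks of endomorphisms, so the tail of the sum is first realised as one. *)
have [h hE] : exists h : endo M, forall x, h x = \sum_(q <- s | q.1 x) q.2.
  exists (\sum_(q <- s) step q.1 q.2) => x.
  elim: s {IHs gE} => [|q s IHs]; first by rewrite !big_nil endo0E.
  by rewrite !big_cons endoE IHs /= /step_fun; case: ifP; rewrite ?add0r.
rewrite [g](_ : _ = step p b + h).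
  by apply: ID (IHs _ hE); rewrite -(step_mul p b fm0); apply/Ir/Il.
apply: endoP => x; rewrite gE endoE hE /= /step_fun big_cons /=.
by case: (p x); rewrite ?add0r.
Qed.

Lemma endo_neq0 f : f <> 0 -> exists m, f m != 0.
Proof.
move=> f0; apply: contra_notP f0 => /forallNP fE; apply: endoP => x.
by rewrite endo0E; apply/eqP/negPn/negP/fE.
Qed.

Lemma ideal_simple_step_sum1 :
  ideal_simple (endo M) <-> step_sum (1 : endo M).
Proof.
split=> [simple|sum1 I idI].
  have [E|->] := simple _ step_sum_ideal; last by [].
  suff -> : (1 : endo M) = 0 by case: step_sum_ideal.
  (* This step map fixes [x]; if it is zero, so is [x], and [M] is trivial. *)
  apply: endoP => x; have := step_in_step_sum nonzero_character x.
  rewrite E /= => /(congr1 (fun f : endo M => f x)) /=.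
  by rewrite /step_fun /=; case: eqVneq.
have [If|/existsNP[f /not_implyP[If /endo_neq0[m fm0]]]] :=
    pselect (forall f, I f -> f = 0); [left|right].
  by apply/seteqP; split=> [f /If|f ->] //; case: idI.
apply/seteqP; split=> // g _; rewrite -[g]mulr1.
by case: (idI) => _ _ Il _; apply/Il/(step_sum_sub_ideal idI If fm0).
Qed.

(** * Congruences *)

Lemma congruence_kernel_ideal (C : endo M -> endo M -> Prop) :
  is_congruence C -> is_ideal (fun f => C f 0).
Proof.
move=> [[Cr Cs Ct] CD CM]; split=> [|f g f0 g0|r f f0|r f f0].
- exact: Cr.
- by rewrite -[0](addr0 0); apply: CD.
- by rewrite -(mulr0 r); apply: CM => //; apply: Cr.
- by rewrite -(mul0r r); apply: CM => //; apply: Cr.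
Qed.

Lemma ideal_simple_congruence_simple :
  ideal_simple (endo M) -> congruence_simple (endo M).
Proof.
move=> simple C congC; have [[Cr Cs Ct] CD CM] := congC.
have [eqC|] := pselect (forall f g, C f g -> f = g).
  by left=> f g; split=> [/eqC|->].
move=> /existsNP[f /existsNP[g /not_implyP[Cfg fg]]]; right.
have [h h0 Ch0] : exists2 h : endo M, h <> 0 & C h 0.
  have [m fgm] : exists m, f m <> g m.
    by apply/existsNP => /(endoP (f := f) (g := g)).
  (* Multiplying by a step map on each side sends [v] to zero, its values being at most [v m], while
     the product with [u] still sends [m] to [u m], which is nonzero. *)
  have separate (u v : endo M) : C u v -> ~ u m <=s v m ->
      exists2 h : endo M, h <> 0 & C h 0.
    move=> Cuv uvm; exists (step (not_below (v m)) (u m) * u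
        * step nonzero_character m); last first.
      rewrite [X in C _ X](_ : 0 = step (not_below (v m)) (u m) * v
        * step nonzero_character m); first by apply/CM/Cr; apply/CM/Cuv/Cr.
      apply: endoP => x; rewrite !endoE /= /step_fun /= asbool_neg.
      suff /asboolT -> : v (if x != 0 then m else 0) <=s v m by [].
      by case: ifP => _; rewrite ?raddf0; [apply: sle_refl|apply: sle0x].
    have m0 : m != 0 by apply: contra_not_neq uvm => ->;
      rewrite !raddf0; apply: sle0x.
    move=> /(congr1 (fun f : endo M => f m)) /=; rewrite /step_fun /= m0.
    case: asboolP => // _ um0; apply: uvm; rewrite um0; exact: sle0x.
  have [fgle|] := pselect (f m <=s g m); last exact: separate.
  apply: separate (Cs _ _ Cfg) _ => gfle; exact/fgm/sle_anti.
have [E|E] := simple _ (congruence_kernel_ideal congC).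
  by case: h0; have : [set 0]%classic h by rewrite -E.
have C0 u : C u 0 by have : [set: endo M]%classic u by []; rewrite -E.
by move=> u v; apply: Ct (C0 u) (Cs _ _ (C0 v)).
Qed.

End Idempotent.

(** * The lattice built from a step sum equal to the identity *)

Section DistrLattice.
Variables (M : nmodType) (addxx : forall x : M, x + x = x).
Variable s : seq (character M * M).
Hypothesis sE : forall x, x = \sum_(q <- s | q.1 x) q.2.

(* A copy of [M] that mentions both hypotheses, so that the order structure
   below, which needs them, can be attached to it. *)
Definition character_lattice : Type :=
  let _ := addxx in let _ := sE in M.
Local Notation L := character_lattice.

Definition character_code (x : L) : {ffun 'I_(size s) -> bool} :=
  [ffun i => (tnth (in_tuple s) i).1 x].

Definition character_decode (u : {ffun 'I_(size s) -> bool}) : L :=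
  \sum_(i | u i) (tnth (in_tuple s) i).2.

(** The sum in [sE] depends on [x] only through its code; this is what makes [M] finite. *)
Lemma character_codeK : cancel character_code character_decode.
Proof.
move=> x; rewrite [RHS]sE [RHS](big_tuple _ _ (in_tuple s)).
by apply: eq_bigl => i; rewrite ffunE.
Qed.

Definition character_le (x y : L) : bool := `[< (x : M) <=s y >].
Definition character_join (x y : L) : L := (x : M) + y.
Definition character_meet (x y : L) : L := \sum_(q <- s | q.1 x && q.1 y) q.2.

Fact character_le_refl : reflexive character_le.
Proof. by move=> x; apply/asboolP/sle_refl. Qed.

Fact character_le_anti : antisymmetric character_le.
Proof. by move=> x y /andP[/asboolP xy /asboolP yx]; apply: sle_anti yx. Qed.

Fact character_le_trans : transitive character_le.
Proof.
by move=> y x z /asboolP xy /asboolP yz; apply/asboolP/(sle_trans xy yz).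
Qed.

(** Dropping terms from the sum for [y] or [z] gives a lower bound; it is the greatest one because
    characters are monotone. *)
Fact character_meetP x y z :
  character_le x (character_meet y z) = character_le x y && character_le x z.
Proof.
apply/asboolP/andP => [le_x|[/asboolP xy /asboolP xz]].
  by split; apply/asboolP; apply: (sle_trans le_x);
    rewrite [X in _ <=s X]sE; apply: sle_sum_sub => // q /andP[].
rewrite [x]sE; apply: sle_sum_sub => // q qx.
by rewrite !(character_homo _ qx).
Qed.

Fact character_joinP x y z :
  character_le (character_join x y) z = character_le x z && character_le y z.
Proof. by rewrite -asbool_and; apply: asbool_equiv_eq; apply: addr_sle. Qed.

Fact character_meetUl : left_distributive character_meet character_join.
Proof.
move=> x y z; rewrite /character_join /character_meet -sum_orb //.
by apply: eq_bigl => q; rewrite characterD andb_orl.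
Qed.

HB.instance Definition _ := Choice.copy L (M : Type).
HB.instance Definition _ : isCountable L := CanIsCountable character_codeK.
HB.instance Definition _ : isFinite L := CanIsFinite character_codeK.
HB.instance Definition _ := Order.Le_isPOrder.Build (Order.Disp tt tt) L
  character_le_refl character_le_anti character_le_trans.
HB.instance Definition _ := Order.POrder_MeetJoin_isLattice.Build
  (Order.Disp tt tt) L character_meetP character_joinP.
HB.instance Definition _ := Order.Lattice_Meet_isDistrLattice.Build
  (Order.Disp tt tt) L character_meetUl.

Lemma step_sum1_finite_distr_lattice : is_finite_distr_lattice M.
Proof.
exists (Order.Disp tt tt), (L : finDistrLatticeType _), id.
by split=> [|x y]; [exists id|split=> /asboolP].
Qed.

End DistrLattice.

(** * Join-prime decomposition in a finite distributive lattice *)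

Lemma finite_distr_lattice_step_sum1 (M : nmodType)
    (addxx : forall x : M, x + x = x) :
  is_finite_distr_lattice M -> step_sum (1 : endo M).
Proof.
move=> [d [L [f [[g fK gK] fle]]]].
have fleP x y : reflect (x <=s y) (f x <= f y)%O by apply/(iffP idP) => /fle.
have fD x y : f (x + y) = (f x `|` f y)%O.
  apply/le_anti/andP; split; last first.
    by rewrite leUx; apply/andP; split; apply/fleP;
      [apply: sle_addl|apply: sle_addr].
  rewrite -(gK (f x `|` f y)%O); apply/fleP/addr_sle => //.
  by split; apply/fleP; rewrite gK ?leUl ?leUr.
pose prime j := j <> 0 /\ forall x y : M, j <=s (x + y) -> j <=s x \/ j <=s y.
(* For prime [j], being above [j] is a character; [nonzero_character] is a default for the other
   [j], which [s] leaves out. *)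
have charP j : exists p : character M, prime j -> forall x, p x <-> j <=s x.
  have [[j0 jD]|nprime] := pselect (prime j); last first.
    by exists (nonzero_character addxx) => /nprime.
  have p0 : `[< j <=s 0 >] = false.
    by apply/asboolPn => j_le0; apply/j0/sle_anti/sle0x.
  have pD : {morph (fun x => `[< j <=s x >]) : x y / x + y >-> x || y}.
    move=> x y; rewrite -asbool_or; apply: asbool_equiv_eq; split=> [/jD //|].
    by case=> jx; apply: (sle_trans jx); [apply: sle_addl|apply: sle_addr].
  by exists (Character p0 pD) => _ x; split=> [/asboolP|/asboolP].
have [char charE] := choice charP.
pose s := [seq (char j, j) | j <- [seq g l | l <- enum L] & `[< prime j >]].
exists s => x; apply: sle_anti; last first.
  rewrite big_map big_filter_cond; apply: sle_sum => // j /andP[/asboolP pj].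
  by move/charE; apply.
(* Induction on the number of elements strictly below [x]. *)
have [n] := ubnP #|[pred l : L | (l < f x)%O]|; elim: n x => // n IHn x.
rewrite ltnS => le_xn.
have [x0|/eqP x_neq0] := eqVneq x 0; first by rewrite /= x0; apply: sle0x.
have [px|] := pselect (prime x).
  rewrite big_map big_filter_cond (big_rem x) /=; last first.
    by rewrite -(fK x) map_f // mem_enum.
  rewrite (asboolT px) (charE x px x).2; last exact: sle_refl.
  exact: sle_addl.
(* Here [x] is below [y + z] but below neither term, so by distributivity it is the join of its
   meets with [y] and [z], both strictly smaller. *)
move=> /not_andP[//|/existsNP[y /existsNP[z /not_implyP[xyz /not_orP[xy xz]]]]].
have part w : ~ x <=s w -> g (f x `&` f w)%O <=s \sum_(q <- s | q.1 x) q.2.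
  move=> xw; apply: sle_trans (IHn _ _) _.
    apply: leq_trans le_xn; apply: proper_card; apply/properP.
    rewrite gK; split.
      apply/fintype.subsetP => l; rewrite !inE => /lt_le_trans; apply.
      exact: leIl.
    exists (f x `&` f w)%O; rewrite !inE ?ltxx //.
    rewrite lt_neqAle leIl andbT.
    by apply/negP; rewrite -leEmeet => /fleP.
  apply: sle_sum_sub => // q; apply: character_homo; apply/fleP.
  by rewrite gK leIl.
rewrite [X in X <=s _](_ : _ = g (f x `&` f y)%O + g (f x `&` f z)%O).
  by apply/addr_sle => //; split; apply: part.
apply: (can_inj fK); rewrite fD !gK -meetUr -fD.
by apply/esym/eqP; rewrite -leEmeet; apply/fleP.
Qed.

Theorem theorem3p3 (M : nmodType) (addxx : forall x : M, x + x = x) :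
  (simple_semiring (endo M) <-> ideal_simple (endo M)) /\
  (ideal_simple (endo M) <-> is_finite_distr_lattice M).
Proof.
split; first by split=> [[]|simple] //; split=> //;
  apply: ideal_simple_congruence_simple.
rewrite ideal_simple_step_sum1 //.
split=> [[s sE]|]; last exact: finite_distr_lattice_step_sum1.
exact: (step_sum1_finite_distr_lattice addxx sE).
Qed.
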